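(* Let $n\ge 1$ and let $f:\mathbf{M}^n\to\mathbb{R}$ be a submodular function with $f(\mathbf{0}_{\mathbf{M}^n})=0$. Then \[ \min_{\mathbf{t}\in \mathbf{M}^n} f(\mathbf{t}) \;=\; \max\left\{ \mathbf{z}(\mathbf{1}_{\mathbf{M}^n}) \;\middle|\; \mathbf{z}\in P_M(f),\ \mathbf{z}\le 0,\ \mathbf{z}\text{ is unified}\right\}. \] Moreover, if $f$ is integer-valued, then there is an integer-valued vector $\mathbf{z}$ attaining the maximum on the right-hand side.
   Context: Let $\mathbf{M}$ be a diamond: its elements are a bottom $0_M$, a top $1_M$, and a finite set $A$ of atoms with $|A|\ge 3$, where $0_M<a<1_M$ for every $a\in A$ and distinct atoms are incomparable (so $a\wedge b=0_M$, $a\vee b=1_M$ for distinct $a,b\in A$). For $n\ge 1$, $\mathbf{M}^n$ is the product lattice with coordinatewise order, meet and join; $\mathbf{0}_{\mathbf{M}^n}$ and $\mathbf{1}_{\mathbf{M}^n}$ denote its bottom and top. A function $f:\mathbf{M}^n\to\mathbb{R}$ is submodular if $f(\mathbf{s}\wedge\mathbf{t})+f(\mathbf{s}\vee\mathbf{t})\le f(\mathbf{s})+f(\mathbf{t})$ for all $\mathbf{s},\mathbf{t}\in\mathbf{M}^n$. Vectors are elements $\mathbf{x}\in\mathbb{R}^{[n]\times A}$, with entries $\mathbf{x}(i,a)$; $\mathbf{x}\le 0$ means all entries are $\le 0$. For $\mathbf{x}\in\mathbb{R}^{[n]\times A}$ and $\mathbf{y}\in\mathbf{M}^n$ define $\mathbf{x}(\mathbf{y})=\sum_{i=1}^n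 g_i$, where $g_i=0$ if $\mathbf{y}(i)=0_M$, $g_i=\mathbf{x}(i,\mathbf{y}(i))$ if $\mathbf{y}(i)\in A$, and $g_i=\max_{a,a'\in A,\,a\ne a'}(\mathbf{x}(i,a)+\mathbf{x}(i,a'))$ if $\mathbf{y}(i)=1_M$. Let $P_M(f)=\{\mathbf{x}\in\mathbb{R}^{[n]\times A}\mid \mathbf{x}(\mathbf{y})\le f(\mathbf{y})\ \text{for all }\mathbf{y}\in\mathbf{M}^n\}$. A vector $\mathbf{x}\in\mathbb{R}^{[n]\times A}$ is unified if for every $i\in[n]$ there is an atom $p\in A$ such that $\mathbf{x}(i,a)=\mathbf{x}(i,b)$ for all $a,b\in A\setminus\{p\}$ and $\mathbf{x}(i,p)\ge \mathbf{x}(i,a)$ for all $a\in A$. *)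

(* Defs.v *)
From HB Require Import structures.
From mathcomp Require Import all_boot all_order all_algebra.
From mathcomp Require Import reals.

Set Implicit Arguments.
Unset Strict Implicit.
Unset Printing Implicit Defensive.

Import Order.TTheory GRing.Theory Num.Theory.

Local Open Scope ring_scope.

Variant diamond (A : Type) : Type := DBot | DAtom of A | DTop.
Arguments DBot {A}.
Arguments DTop {A}.

Section DiamondFinite.
Variable A : Type.

Definition diamond_code (y : diamond A) : option (option A) :=
  match y with DBot => None | DTop => Some None | DAtom a => Some (Some a) end.

Definition diamond_decode (c : option (option A)) : diamond A :=
  match c with
  | None => DBot | Some None => DTop | Some (Some a) => DAtom a
  end.

Lemma diamond_codeK : cancel diamond_code diamond_decode.
Proof. by case. Qed.

End DiamondFinite.

HB.instance Definition _ (A : eqType) :=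
  Equality.copy (diamond A) (can_type (@diamond_codeK A)).
HB.instance Definition _ (A : choiceType) :=
  Choice.copy (diamond A) (can_type (@diamond_codeK A)).
HB.instance Definition _ (A : countType) :=
  Countable.copy (diamond A) (can_type (@diamond_codeK A)).
HB.instance Definition _ (A : finType) :=
  Finite.copy (diamond A) (can_type (@diamond_codeK A)).

Fact diamond_display : Order.disp_t. Proof. exact: Order.Disp tt tt. Qed.

Section DiamondLattice.
Variable A : finType.
Implicit Types x y z : diamond A.

Definition diamond_le x y : bool :=
  match x, y with
  | DBot, _ | _, DTop => true
  | DAtom a, DAtom b => a == b
  | _, _ => false
  end.

Definition diamond_meet x y : diamond A :=
  match x, y with
  | DTop, z | z, DTop => z
  | DAtom a, DAtom b => if a == b then DAtom a else DBot
  | _, _ => DBot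
  end.

Definition diamond_join x y : diamond A :=
  match x, y with
  | DBot, z | z, DBot => z
  | DAtom a, DAtom b => if a == b then DAtom a else DTop
  | _, _ => DTop
  end.

Fact diamond_le_refl : reflexive diamond_le.
Proof. by case=> //= a. Qed.

Fact diamond_le_anti : antisymmetric diamond_le.
Proof. by case=> [|a|] [|b|] //= /andP[/eqP->]. Qed.

Fact diamond_le_trans : transitive diamond_le.
Proof. by case=> [|a|] [|b|] [|c|] //= /eqP-> /eqP->. Qed.

HB.instance Definition _ :=
  Order.Le_isPOrder.Build diamond_display (diamond A)
    diamond_le_refl diamond_le_anti diamond_le_trans.

Fact diamond_meetP x y z :
  (x <= diamond_meet y z)%O = (x <= y)%O && (x <= z)%O.
Proof.
rewrite /Order.le /=; case: x y z => [|a|] [|b|] [|c|] //=;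
  rewrite ?andbT ?andbF ?andbb //; try by case: (b == c).
have [->|bc] := eqVneq b c; first by rewrite /= andbb.
by have [->|//] := eqVneq a b; rewrite /= (negPf bc).
Qed.

Fact diamond_joinP x y z :
  (diamond_join x y <= z)%O = (x <= z)%O && (y <= z)%O.
Proof.
rewrite /Order.le /=; case: x y z => [|a|] [|b|] [|c|] //=;
  rewrite ?andbT ?andbF ?andbb //; try by case: (a == b).
have [->|ab] := eqVneq a b; first by rewrite /= andbb.
by have [<-|//] := eqVneq a c; rewrite /= eq_sym (negPf ab).
Qed.

HB.instance Definition _ :=
  Order.POrder_MeetJoin_isLattice.Build diamond_display (diamond A)
    diamond_meetP diamond_joinP.

Fact diamond_le0x x : (DBot <= x)%O.
Proof. by case: x. Qed.

Fact diamond_lex1 x : (x <= DTop)%O.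
Proof. by case: x. Qed.

HB.instance Definition _ :=
  Order.hasBottom.Build diamond_display (diamond A) diamond_le0x.
HB.instance Definition _ :=
  Order.hasTop.Build diamond_display (diamond A) diamond_lex1.

End DiamondLattice.

(* [n.-tupleprod T] carries the coordinatewise order, meet and join. *)
Definition diamond_pow (A : finType) (n : nat) : finTBLatticeType _ :=
  n.-tupleprod (diamond A).

Definition submodular (R : numDomainType) (d : Order.disp_t)
    (L : latticeType d) (f : L -> R) : Prop :=
  forall s t : L, f (Order.meet s t) + f (Order.join s t) <= f s + f t.

(* The maximum of a nonempty sequence; the default value [head 0 s] is an item
   of [s] as soon as [s] is nonempty. *)
Definition seqmax (R : realDomainType) (s : seq R) : R :=
  \big[Num.max/head 0 s]_(v <- s) v.

Lemma seqmax_mem (R : realDomainType) (s : seq R) : s != [::] -> seqmax s \in s.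
Proof.
case: s => // v s _; rewrite /seqmax /= big_seq.
elim/big_ind: _ => //; first exact: mem_head.
by move=> a b sa sb; case: (leP a b).
Qed.

Lemma seqmax_ge (R : realDomainType) (s : seq R) v : v \in s -> v <= seqmax s.
Proof. by move=> sv; apply: le_bigmax_seq sv _. Qed.

Section Polyhedron.
Variables (R : realType) (A : finType) (n : nat).

Definition dvec : Type := {ffun 'I_n * A -> R}.

Definition coord_val (x : dvec) (i : 'I_n) (y : diamond A) : R :=
  match y with
  | DBot => 0
  | DAtom a => x (i, a)
  | DTop => seqmax [seq x (i, p.1) + x (i, p.2)
                     | p in [pred p : A * A | p.1 != p.2]]
  end.

Definition dval (x : dvec) (y : diamond_pow A n) : R :=
  \sum_(i < n) coord_val x i (tnth y i).

Definition in_PM (f : diamond_pow A n -> R) (x : dvec) : Prop :=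
  forall y : diamond_pow A n, dval x y <= f y.

Definition nonpositive (x : dvec) : Prop :=
  forall (i : 'I_n) (a : A), x (i, a) <= 0.

Definition unified (x : dvec) : Prop :=
  forall i : 'I_n, exists p : A,
    (forall a b : A, a != p -> b != p -> x (i, a) = x (i, b)) /\
    (forall a : A, x (i, a) <= x (i, p)).

Definition integer_vec (x : dvec) : Prop :=
  forall (i : 'I_n) (a : A), x (i, a) \is a Num.int.

End Polyhedron.

Definition is_min (R : realType) (T : Type) (P : T -> Prop) (g : T -> R)
    (m : R) : Prop :=
  (exists2 t, P t & g t = m) /\ (forall t, P t -> m <= g t).

Definition is_max (R : realType) (T : Type) (P : T -> Prop) (g : T -> R)
    (m : R) : Prop :=
  (exists2 t, P t & g t = m) /\ (forall t, P t -> g t <= m).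

(* Main.v *)
Require Import Defs.
From mathcomp Require Import all_boot all_order all_algebra.
From mathcomp Require Import reals lra.

Import Order.TTheory GRing.Theory Num.Theory.

Local Open Scope ring_scope.

(** Weak duality holds because a nonpositive unified vector is antitone on
    [M^n].  For the converse, replace [f] by its monotone closure
    [y |-> min_(t <= y) f t], which is still submodular, lies below [f], and
    takes the value [min f] at the top.  Edmonds' greedy algorithm applied to
    the closure along a maximal chain of [M^n] gives the required vector: the
    chain raises the coordinates to the top one after the other, coordinate
    [i] passing through the atom [p] of largest value.  This choice of [p]
    makes the greedy vector unified, and submodularity makes it feasible. *)

(** * Monotone closure of a submodular function *)

Definition monotone_closure {R : realType} {d : Order.disp_t}
    {L : finTBLatticeType d} (f : L -> R) (y : L) : R :=
  f [arg min_(t < \bot%O | (t <= y)%O) f t]%O.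

Lemma monotone_closure_attained {R : realType} {d : Order.disp_t}
    {L : finTBLatticeType d} (f : L -> R) (y : L) :
  exists2 t, (t <= y)%O & monotone_closure f y = f t.
Proof.
by rewrite /monotone_closure; case: arg_minP => [|t ty _]; [exact: le0x|exists t].
Qed.

Lemma monotone_closure_le {R : realType} {d : Order.disp_t}
    {L : finTBLatticeType d} (f : L -> R) (y t : L) :
  (t <= y)%O -> monotone_closure f y <= f t.
Proof.
by rewrite /monotone_closure; case: arg_minP => [|u _ umin /umin]; first exact: le0x.
Qed.

Lemma monotone_closure_antitone {R : realType} {d : Order.disp_t}
    {L : finTBLatticeType d} (f : L -> R) (s t : L) :
  (s <= t)%O -> monotone_closure f t <= monotone_closure f s.
Proof.
move=> st; have [u us ->] := monotone_closure_attained f s.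
exact/monotone_closure_le/(le_trans us).
Qed.

Lemma monotone_closure_bot {R : realType} {d : Order.disp_t}
    {L : finTBLatticeType d} (f : L -> R) :
  monotone_closure f \bot%O = f \bot%O.
Proof.
have [t + ->] := monotone_closure_attained f \bot%O.
by rewrite lex0 => /eqP->.
Qed.

(** Minimisers [s'] below [s] and [t'] below [t] have their meet below that of [s] and [t], and
    likewise their join, so submodularity of [f] at [s'], [t'] is enough. *)
Lemma monotone_closure_submodular {R : realType} {d : Order.disp_t}
    {L : finTBLatticeType d} (f : L -> R) :
  submodular f -> submodular (monotone_closure f).
Proof.
move=> hf s t.
have [s' s's ->] := monotone_closure_attained f s.
have [t' t't ->] := monotone_closure_attained f t.
apply: le_trans (hf s' t').
by apply: lerD; apply: monotone_closure_le; [exact: leI2|exact: leU2].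
Qed.

(** * Truncations and the points of the maximal chains *)

Definition truncate {A : finType} {n : nat} (y : diamond_pow A n) (k : nat) :
    diamond_pow A n :=
  [tuple if (i < k)%N then tnth y i else DBot | i < n].

Definition chain_point {A : finType} {n : nat} (k : nat) (c : diamond A) :
    diamond_pow A n :=
  [tuple if (i < k)%N then DTop else if i == k :> nat then c else DBot | i < n].

Lemma truncate0 {A : finType} {n : nat} (y : diamond_pow A n) :
  truncate y 0 = \bot%O.
Proof. by rewrite botEtprod; apply: eq_from_tnth => i; rewrite !tnth_mktuple. Qed.

Lemma truncate_id {A : finType} {n : nat} (y : diamond_pow A n) :
  truncate y n = y.
Proof. by apply: eq_from_tnth => i; rewrite !tnth_mktuple ltn_ord. Qed.

Lemma chain_point_bot {A : finType} {n : nat} (k : nat) :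
  chain_point k DBot = truncate \top%O k :> diamond_pow A n.
Proof.
by apply: eq_from_tnth => i; rewrite topEtprod !tnth_mktuple; case: ltngtP.
Qed.

Lemma chain_point_top {A : finType} {n : nat} (k : nat) :
  chain_point k DTop = truncate \top%O k.+1 :> diamond_pow A n.
Proof.
apply: eq_from_tnth => i; rewrite topEtprod !tnth_mktuple ltnS.
by case: ltngtP.
Qed.

Lemma chain_point_meet {A : finType} {n : nat} (k : nat) (c d : diamond A) :
  (chain_point k c `&` chain_point k d)%O
  = chain_point k (c `&` d)%O :> diamond_pow A n.
Proof.
by apply: eq_from_tnth => i; rewrite tnth_meet !tnth_mktuple; case: ltngtP.
Qed.

Lemma chain_point_join {A : finType} {n : nat} (k : nat) (c d : diamond A) :
  (chain_point k c `|` chain_point k d)%O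
  = chain_point k (c `|` d)%O :> diamond_pow A n.
Proof.
by apply: eq_from_tnth => i; rewrite tnth_join !tnth_mktuple; case: ltngtP.
Qed.

Lemma chain_point_le {A : finType} {n : nat} (k : nat) (c d : diamond A) :
  (c <= d)%O -> ((chain_point k c : diamond_pow A n) <= chain_point k d)%O.
Proof.
move=> cd; rewrite leEtprod; apply/forallP => i.
by rewrite !tnth_mktuple; case: ltngtP.
Qed.

Lemma submodular_chain_atoms {R : realType} {A : finType} {n : nat}
    (g : diamond_pow A n -> R) (k : nat) (a b : A) :
  submodular g -> a != b ->
  g (chain_point k DBot) + g (chain_point k DTop)
  <= g (chain_point k (DAtom a)) + g (chain_point k (DAtom b)).
Proof.
move=> hg ab; have := hg (chain_point k (DAtom a)) (chain_point k (DAtom b)).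
rewrite chain_point_meet chain_point_join.
by rewrite /Order.meet /Order.join /= (negPf ab).
Qed.

(** Diminishing returns: raising coordinate [k] gains least when all earlier coordinates are already
    at the top. The two right-hand points of submodularity are [truncate y k.+1] and
    [chain_point k DBot]. *)
Lemma submodular_truncate {R : realType} {A : finType} {n : nat}
    (g : diamond_pow A n -> R) (y : diamond_pow A n) (k : 'I_n) :
  submodular g ->
  g (chain_point k (tnth y k)) - g (chain_point k DBot)
  <= g (truncate y k.+1) - g (truncate y k).
Proof.
move=> hg; have := hg (truncate y k.+1) (chain_point k DBot).
have -> : (truncate y k.+1 `&` chain_point k DBot)%O = truncate y k.
  apply: eq_from_tnth => i; rewrite tnth_meet !tnth_mktuple ltnS.
  by case: ltngtP => _; rewrite ?meetx1 ?meetx0.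
have -> : (truncate y k.+1 `|` chain_point k DBot)%O = chain_point k (tnth y k).
  apply: eq_from_tnth => i; rewrite tnth_join !tnth_mktuple ltnS.
  by case: ltngtP => [_|_|/val_inj->]; rewrite ?joinx1 ?joinx0.
lra.
Qed.

(** * Values at the top and weak duality *)

Lemma exists_other_atom {A : finType} (p : A) :
  (1 < #|A|)%N -> exists a : A, a != p.
Proof.
move=> hA; have /card_gt0P[a] : (0 < #|predC1 p|)%N.
  by rewrite cardC1 -subn1 subn_gt0.
by exists a.
Qed.

(** A pair of distinct atoms contains [p] at most once, so its sum is [x (i, p) + c] or [c + c];
    pairing [p] with any other atom attains the former. *)
Lemma coord_val_top {R : realType} {A : finType} {n : nat} (x : dvec R A n)
    (i : 'I_n) (p : A) (c : R) :
  (1 < #|A|)%N -> (forall a, a != p -> x (i, a) = c) -> c <= x (i, p) ->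
  coord_val x i DTop = x (i, p) + c.
Proof.
move=> hA xc cp; have [q qp] := exists_other_atom p hA.
rewrite /coord_val; set s := (X in seqmax X).
have pcs : x (i, p) + c \in s.
  by apply/imageP; exists (p, q); rewrite ?inE /= 1?eq_sym // (xc q).
apply/eqP; rewrite eq_le seqmax_ge // andbT.
(* By [pcs] the sequence is nonempty, so its maximum is the sum of an actual pair and not a default
   value. *)
have /seqmax_mem/imageP[[a b]] : s != [::] by apply: contraTneq pcs => ->.
rewrite inE /= => ab ->.
have [ap|/xc->] := eqVneq a p; last have [->|/xc->] := eqVneq b p.
- by rewrite ap (xc b) // -ap eq_sym.
- by rewrite addrC.
- exact: lerD.
Qed.

(** The top value is the sum of the entries at [p] and at some [q] distinct from [p]. Both are
    nonpositive, so the sum is below each of them and below 0. *)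
Lemma coord_val_top_le {R : realType} {A : finType} {n : nat} (x : dvec R A n)
    (i : 'I_n) (c : diamond A) :
  (1 < #|A|)%N -> nonpositive x -> unified x ->
  coord_val x i DTop <= coord_val x i c.
Proof.
move=> hA x0 ux; have [p [xq xp]] := ux i.
have [q qp] := exists_other_atom p hA.
have xE a : a != p -> x (i, a) = x (i, q) by move=> ap; apply: xq.
rewrite (coord_val_top _ _ _ _ hA xE (xp q)).
have [p0 q0] := (x0 i p, x0 i q).
case: c => [|a|] /=; first by lra.
- by have [->|/xE->] := eqVneq a p; lra.
- by rewrite -[seqmax _]/(coord_val x i DTop) (coord_val_top _ _ _ _ hA xE (xp q)).
Qed.

Lemma dval_top_le {R : realType} {A : finType} {n : nat} (x : dvec R A n)
    (y : diamond_pow A n) :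
  (1 < #|A|)%N -> nonpositive x -> unified x -> dval x \top%O <= dval x y.
Proof.
move=> hA x0 ux; apply: ler_sum => i _.
by rewrite topEtprod tnth_mktuple; apply: coord_val_top_le.
Qed.

(** * The greedy vector *)

Definition peak {R : realType} {A : finType} {n : nat}
    (g : diamond_pow A n -> R) (a0 : A) (i : 'I_n) : A :=
  [arg max_(a > a0) g (chain_point i (DAtom a))]%O.

(** On the way from bottom through the peak to top, the peak receives the first increment of [g] and
    every other atom the second. *)
Definition greedy {R : realType} {A : finType} {n : nat}
    (g : diamond_pow A n -> R) (a0 : A) : dvec R A n :=
  [ffun ia : 'I_n * A => let i := ia.1 in let p := DAtom (peak g a0 i) in
    if ia.2 == peak g a0 i then g (chain_point i p) - g (chain_point i DBot)
    else g (chain_point i DTop) - g (chain_point i p)].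

Lemma greedy_peak {R : realType} {A : finType} {n : nat}
    (g : diamond_pow A n -> R) (a0 : A) (i : 'I_n) :
  greedy g a0 (i, peak g a0 i)
  = g (chain_point i (DAtom (peak g a0 i))) - g (chain_point i DBot).
Proof. by rewrite ffunE /= eqxx. Qed.

Lemma greedy_other {R : realType} {A : finType} {n : nat}
    (g : diamond_pow A n -> R) (a0 : A) (i : 'I_n) (a : A) :
  a != peak g a0 i ->
  greedy g a0 (i, a)
  = g (chain_point i DTop) - g (chain_point i (DAtom (peak g a0 i))).
Proof. by move=> ap; rewrite ffunE /= (negPf ap). Qed.

Lemma peak_max {R : realType} {A : finType} {n : nat}
    (g : diamond_pow A n -> R) (a0 : A) (i : 'I_n) (a : A) :
  g (chain_point i (DAtom a)) <= g (chain_point i (DAtom (peak g a0 i))).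
Proof. by rewrite /peak; case: arg_maxP => // p _ /(_ a isT). Qed.

(** Submodularity at [a] and the peak, with maximality of the peak, bounds the sum of [g] at the two
    ends of the step by twice its value at the peak; hence the second increment is at most the
    first. *)
Lemma greedy_le_peak {R : realType} {A : finType} {n : nat}
    (g : diamond_pow A n -> R) (a0 : A) (i : 'I_n) (a : A) :
  submodular g -> greedy g a0 (i, a) <= greedy g a0 (i, peak g a0 i).
Proof.
move=> hg; have [->//|ap] := eqVneq a (peak g a0 i).
rewrite greedy_peak greedy_other //.
have := submodular_chain_atoms g i _ _ hg ap; have := peak_max g a0 i a.
lra.
Qed.

Lemma greedy_unified {R : realType} {A : finType} {n : nat}
    (g : diamond_pow A n -> R) (a0 : A) :
  submodular g -> unified (greedy g a0).
Proof.
move=> hg i; exists (peak g a0 i); split=> [a b ap bp|a].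
  by rewrite !greedy_other.
exact: greedy_le_peak.
Qed.

Lemma greedy_nonpositive {R : realType} {A : finType} {n : nat}
    (g : diamond_pow A n -> R) (a0 : A) :
  (forall s t, (s <= t)%O -> g t <= g s) -> nonpositive (greedy g a0).
Proof.
move=> g_anti i a; have [->|ap] := eqVneq a (peak g a0 i).
  by rewrite greedy_peak subr_le0; apply/g_anti/chain_point_le.
by rewrite greedy_other // subr_le0; apply/g_anti/chain_point_le.
Qed.

Lemma coord_val_greedy_top {R : realType} {A : finType} {n : nat}
    (g : diamond_pow A n -> R) (a0 : A) (i : 'I_n) :
  (1 < #|A|)%N -> submodular g ->
  coord_val (greedy g a0) i DTop
  = g (chain_point i DTop) - g (chain_point i DBot).
Proof.
move=> hA hg; have [q qp] := exists_other_atom (peak g a0 i) hA.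
rewrite (coord_val_top _ _ _ _ hA (greedy_other g a0 i)).
  by rewrite greedy_peak; lra.
by rewrite -(greedy_other g a0 i q) // greedy_le_peak.
Qed.

(** Equality holds at bottom, peak and top, where the increments add up; at any other atom the bound
    is submodularity of that atom with the peak. *)
Lemma coord_val_greedy_le {R : realType} {A : finType} {n : nat}
    (g : diamond_pow A n -> R) (a0 : A) (i : 'I_n) (c : diamond A) :
  (1 < #|A|)%N -> submodular g ->
  coord_val (greedy g a0) i c <= g (chain_point i c) - g (chain_point i DBot).
Proof.
move=> hA hg; case: c => [|a|]; last by rewrite coord_val_greedy_top.
  by rewrite /= subrr.
rewrite /=; have [->|ap] := eqVneq a (peak g a0 i); first by rewrite greedy_peak.
rewrite greedy_other //; have := submodular_chain_atoms g i _ _ hg ap.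
lra.
Qed.

Lemma sum_truncate {R : realType} {A : finType} {n : nat}
    (g : diamond_pow A n -> R) (y : diamond_pow A n) :
  \sum_(i < n) (g (truncate y i.+1) - g (truncate y i)) = g y - g \bot%O.
Proof.
rewrite -(big_mkord xpredT (fun i => g (truncate y i.+1) - g (truncate y i))).
by rewrite telescope_sumr // truncate_id truncate0.
Qed.

Lemma greedy_in_PM {R : realType} {A : finType} {n : nat}
    (g : diamond_pow A n -> R) (a0 : A) :
  (1 < #|A|)%N -> submodular g -> g \bot%O = 0 -> in_PM g (greedy g a0).
Proof.
(* As [g] vanishes at the bottom, [g y] telescopes along the truncations of [y], and the comparison
   can be made coordinate by coordinate. *)
move=> hA hg g0 y; rewrite -[g y]subr0 -g0 -sum_truncate.
apply: ler_sum => i _; apply: le_trans (submodular_truncate g y i hg).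
exact: coord_val_greedy_le.
Qed.

(** The truncations of the top are themselves chain points, so the same telescoping holds with
    equality. *)
Lemma dval_greedy_top {R : realType} {A : finType} {n : nat}
    (g : diamond_pow A n -> R) (a0 : A) :
  (1 < #|A|)%N -> submodular g -> g \bot%O = 0 ->
  dval (greedy g a0) \top%O = g \top%O.
Proof.
move=> hA hg g0; rewrite -[RHS]subr0 -g0 -sum_truncate.
apply: eq_bigr => i _; rewrite {1}topEtprod tnth_mktuple.
by rewrite coord_val_greedy_top // chain_point_top chain_point_bot.
Qed.

Lemma greedy_integer {R : realType} {A : finType} {n : nat}
    (g : diamond_pow A n -> R) (a0 : A) :
  (forall y, g y \is a Num.int) -> integer_vec (greedy g a0).
Proof. by move=> gZ i a; rewrite ffunE /=; case: ifP => _; rewrite rpredB. Qed.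

Theorem theorem1 (R : realType) (A : finType) (hA : (3 <= #|A|)%N)
    (n : nat) (hn : (1 <= n)%N) (f : diamond_pow A n -> R)
    (hf : submodular f) (hf0 : f \bot%O = 0) :
  let feasible (z : dvec R A n) :=
    [/\ in_PM f z, nonpositive z & unified z] in
  let top_val (z : dvec R A n) := dval z \top%O in
  (exists m : R, is_min (fun _ => True) f m /\ is_max feasible top_val m) /\
  ((forall t, f t \is a Num.int) ->
   exists z : dvec R A n,
     [/\ feasible z, integer_vec z & is_max feasible top_val (top_val z)]).
Proof.
move=> feasible top_val.
have hA2 : (1 < #|A|)%N by apply: leq_trans hA.
have /card_gt0P[a0 _] : (0 < #|A|)%N by apply: leq_trans hA.
pose g := monotone_closure f; pose z := greedy g a0.
have hg : submodular g by exact: monotone_closure_submodular.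
have g0 : g \bot%O = 0 by rewrite /g monotone_closure_bot.
have z_top : top_val z = g \top%O by exact: dval_greedy_top.
have z_feas : feasible z.
  split; [|exact/greedy_nonpositive/monotone_closure_antitone|exact: greedy_unified].
  move=> y; apply: le_trans (monotone_closure_le f _ _ (le_refl y)).
  exact: greedy_in_PM.
(* Every point lies below the top, so this [t] is a global minimiser of [f]. *)
have [t _ gt] := monotone_closure_attained f \top%O.
have z_max : is_max feasible top_val (top_val z).
  split; first by exists z.
  (* Weak duality at the minimiser: the value of [x] at the top is at most its value at [t], hence
     at most [f t]. *)
  move=> x [xP x0 xu]; rewrite z_top /g gt.
  exact: le_trans (dval_top_le x t hA2 x0 xu) (xP t).
split; last first.
  move=> fZ; exists z; split=> //; apply: greedy_integer => y.
  (* Values of the closure are values of [f], hence integers. *)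
  by rewrite /g; have [u _ ->] := monotone_closure_attained f y.
exists (top_val z); split=> //; rewrite z_top; split; first by exists t.
by move=> s _; apply: monotone_closure_le; apply: lex1.
Qed.
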